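(* Let $\mathsf{K}$ be any one of the following twelve classes of logics (the levels of the Leibniz hierarchy): protoalgebraic logics; equivalential logics; finitely equivalential logics; logics $\mathcal{L}$ such that truth is implicitly definable in $\mathsf{Mod}^{*}\mathcal{L}$; truth-equational logics; assertional logics; weakly algebraizable logics; regularly weakly algebraizable logics; algebraizable logics; finitely algebraizable logics; regularly algebraizable logics; finitely regularly algebraizable logics. Then the problem of determining, given a consistent finite Hilbert calculus in a finite language, whether the logic it determines belongs to $\mathsf{K}$ is undecidable; that is, there is no algorithm which, given as input any consistent finite Hilbert calculus in a finite language, decides whether its logic belongs to $\mathsf{K}$.
   Context: Logics. Fix an algebraic language and a countably infinite set $Var$ of variables. $Fm$ is the set of formulas (terms) over $Var$, and $\boldsymbol{Fm}$ the absolutely free algebra of formulas; substitutions are endomorphisms of $\boldsymbol{Fm}$. A logic $\mathcal{L}$ is a closure operator $C_{\mathcal{L}}$ on $Fm$ with $\sigma C_{\mathcal{L}}(\Gamma)\subseteq C_{\mathcal{L}}(\sigma\Gamma)$ for all substitutions $\sigma$ and $\Gamma \subseteq Fm$; write $\Gamma\vdash_{\mathcal{L}}\varphi$ for $\varphi\in C_{\mathcal{L}}(\Gamma)$. $\mathcal{L}$ is consistent if $\emptyset\nvdash_{\mathcal{L}}\varphi$ for some formula $\varphi$. A rule is an expression $\Gamma\vdash\varphi$ with $\Gamma\cup\{\varphi\}$ a finite set of formulas; a Hilbert calculus is a set of rules. The logic determined by a Hilbert calculus is given by: $\Gamma\vdash\varphi$ iff there is a finite proof of $\varphi$ from $\Gamma$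 using substitution instances of the rules (equivalently, it is the least logic satisfying the rules). A Hilbert calculus is consistent if its logic is. Matrices. For an algebra $\boldsymbol{A}$ (in the language of the logic) and $F\subseteq A$, the Leibniz congruence $\boldsymbol{\Omega}^{\boldsymbol{A}}F$ is the largest congruence $\theta$ of $\boldsymbol{A}$ compatible with $F$ (i.e. $\langle a,b\rangle\in\theta$ and $a\in F$ imply $b\in F$). $F\subseteq A$ is a deductive filter of $\mathcal{L}$ on $\boldsymbol{A}$ if whenever $\Gamma\vdash_{\mathcal{L}}\varphi$ and $h\colon\boldsymbol{Fm}\to\boldsymbol{A}$ is a homomorphism with $h[\Gamma]\subseteq F$, then $h(\varphi)\in F$; $\mathcal{F}i_{\mathcal{L}}\boldsymbol{A}$ is the set of these. A matrix is a pair $\langle\boldsymbol{A},F\rangle$ with $F\subseteq A$. $\mathsf{Mod}^{*}\mathcal{L}=\{\langle\boldsymbol{A},F\rangle: F\in\mathcal{F}i_{\mathcal{L}}\boldsymbol{A},\ \boldsymbol{\Omega}^{\boldsymbol{A}}F=\mathrm{Id}_{\boldsymbol{A}}\}$. Leibniz hierarchy. $\mathcal{L}$ is protoalgebraic if there is a set of formulas $\rho(x,y,\vec z)$ such that for every algebra $\boldsymbol{A}$, $F\in\mathcal{F}i_{\mathcal{L}}\boldsymbol{A}$ and $a,b\in A$: $\langle a,b\rangle\in\boldsymbol{\Omega}^{\boldsymbol{A}}F$ iff $\rho^{\boldsymbol{A}}(a,b,\vec c)\subseteq F$ for all tuples $\vec c$ of elements of $A$. It is equivalential if such a set $\rho(x,y)$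 exists with no parameters $\vec z$ (then $\rho(x,y)$ is called a set of congruence formulas for $\mathcal{L}$). Truth is implicitly definable in a class $\mathsf{M}$ of matrices if $\langle\boldsymbol{A},F\rangle,\langle\boldsymbol{A},G\rangle\in\mathsf{M}$ implies $F=G$. Truth is equationally definable in $\mathsf{M}$ if there is a set $\tau(x)$ of equations in the single variable $x$ such that $F=\{a\in A:\boldsymbol{A}\vDash\tau(a)\}$ for all $\langle\boldsymbol{A},F\rangle\in\mathsf{M}$. $\mathcal{L}$ is truth-equational if truth is equationally definable in $\mathsf{Mod}^{*}\mathcal{L}$. $\mathcal{L}$ is weakly algebraizable if it is protoalgebraic and truth-equational; algebraizable if it is equivalential and truth-equational. $\mathcal{L}$ is assertional if there is a class $\mathsf{C}$ of algebras with a constant term $1$ such that for all $\Gamma\cup\{\varphi\}\subseteq Fm$: $\Gamma\vdash_{\mathcal{L}}\varphi$ iff for every $\boldsymbol{A}\in\mathsf{C}$ and homomorphism $h\colon\boldsymbol{Fm}\to\boldsymbol{A}$, $h[\Gamma]\subseteq\{1\}$ implies $h(\varphi)=1$. $\mathcal{L}$ is regularly (weakly) algebraizable if it is assertional and (weakly) algebraizable. $\mathcal{L}$ is finitely equivalential (resp. finitely algebraizable, finitely regularly algebraizable) if it is equivalential (resp. algebraizable, regularly algebraizable) and has a finite set of congruence formulas. *)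

(* Defs.v *)
From Stdlib Require List.
From Stdlib Require Import Relation_Operators.
From mathcomp Require Import all_boot.
From mathcomp Require Import boolp classical_sets cardinality.

Set Implicit Arguments.
Unset Strict Implicit.
Unset Printing Implicit Defensive.

Local Open Scope classical_set_scope.

Record language := Language { symbol : Type; arity : symbol -> nat }.

Inductive formula (L : language) : Type :=
  | Var of nat
  | App (f : symbol L) of {ffun 'I_(arity f) -> formula L}.

Arguments Var {L}.
Arguments App {L} f.

Lemma formula_nested_ind (L : language) (P : formula L -> Prop) :
  (forall n, P (Var n)) ->
  (forall f (ts : {ffun 'I_(arity f) -> formula L}),
    (forall i, P (ts i)) -> P (App f ts)) ->
  forall phi, P phi.
Proof.
move=> PVar PApp; fix IH 1 => -[n|f ts]; first exact: PVar.
by apply: PApp => i; exact: IH.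
Qed.

Record algebra (L : language) := Algebra {
  carrier :> Type;
  oper : forall f : symbol L, {ffun 'I_(arity f) -> carrier} -> carrier;
  carrier_inhabited : inhabited carrier }.

Arguments oper {L} a f.

Definition Fm (L : language) : algebra L :=
  @Algebra L (formula L) (@App L) (inhabits (Var 0)).

Definition is_hom (L : language) (A B : algebra L) (h : A -> B) : Prop :=
  forall f (ts : {ffun 'I_(arity f) -> A}),
    h (oper A f ts) = oper B f [ffun i => h (ts i)].

Fixpoint variables_in (L : language) (V : set nat) (phi : formula L) : Prop :=
  match phi with
  | Var n => V n
  | App f ts => forall i, variables_in V (ts i)
  end.

Record logic (L : language) := Logic {
  Cn :> set (formula L) -> set (formula L);
  Cn_extensive : forall Gamma, Gamma `<=` Cn Gamma;
  Cn_monotone : forall Gamma Delta, Gamma `<=` Delta -> Cn Gamma `<=` Cn Delta;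
  Cn_idempotent : forall Gamma, Cn (Cn Gamma) `<=` Cn Gamma;
  Cn_structural : forall sigma : Fm L -> Fm L, is_hom sigma ->
    forall Gamma, sigma @` Cn Gamma `<=` Cn (sigma @` Gamma) }.

Definition entails (L : language) (l : logic L) (Gamma : set (formula L))
  (phi : formula L) : Prop := Cn l Gamma phi.

Definition consistent (L : language) (l : logic L) : Prop :=
  exists phi, ~ entails l set0 phi.

Record rule (L : language) := Rule {
  premises : seq (formula L);
  conclusion : formula L }.

Inductive derivable (L : language) (H : set (rule L)) (Gamma : set (formula L)) :
    formula L -> Prop :=
  | derivable_hyp phi : Gamma phi -> derivable H Gamma phi
  | derivable_rule (r : rule L) (sigma : Fm L -> Fm L) :
      H r -> is_hom sigma ->
      (forall gamma, List.In gamma (premises r) ->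
        derivable H Gamma (sigma gamma)) ->
      derivable H Gamma (sigma (conclusion r)).

Section HilbertLogic.
Variables (L : language) (H : set (rule L)).

Let Der (Gamma : set (formula L)) : set (formula L) := derivable H Gamma.

Let Der_extensive Gamma : Gamma `<=` Der Gamma.
Proof. by move=> phi; exact: derivable_hyp. Qed.

Let Der_cut Gamma Delta : Gamma `<=` Der Delta -> Der Gamma `<=` Der Delta.
Proof.
move=> sGD phi; elim=> [psi /sGD //|r sigma Hr hs _ IH].
exact: derivable_rule.
Qed.

Let Der_monotone Gamma Delta : Gamma `<=` Delta -> Der Gamma `<=` Der Delta.
Proof. by move=> sGD; apply: Der_cut => phi /sGD; exact: Der_extensive. Qed.

Let Der_idempotent Gamma : Der (Der Gamma) `<=` Der Gamma.
Proof. exact: Der_cut. Qed.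

Let Der_structural (sigma : Fm L -> Fm L) : is_hom sigma ->
  forall Gamma, sigma @` Der Gamma `<=` Der (sigma @` Gamma).
Proof.
move=> hs Gamma _ [phi der <-]; elim: der => {phi} [phi Gphi|r tau Hr ht _ IH].
  by apply: derivable_hyp; exists phi.
apply: (@derivable_rule _ _ _ r (sigma \o tau)) => // f ts.
by rewrite /= ht hs; congr App; apply/ffunP => i; rewrite !ffunE.
Qed.

Definition hilbert_logic : logic L :=
  Logic Der_extensive Der_monotone Der_idempotent Der_structural.

End HilbertLogic.

Section Matrices.
Variable L : language.

Definition congruence (A : algebra L) (theta : A -> A -> Prop) : Prop :=
  RelationClasses.Equivalence theta /\
  forall f (xs ys : {ffun 'I_(arity f) -> A}),
    (forall i, theta (xs i) (ys i)) -> theta (oper A f xs) (oper A f ys).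

Definition compatible (A : algebra L) (theta : A -> A -> Prop) (F : set A) :=
  forall a b, theta a b -> F a -> F b.

(* The union of the congruences compatible with F; LeibnizP below shows that it
   is itself such a congruence, hence the largest one. *)
Definition Leibniz (A : algebra L) (F : set A) (a b : A) : Prop :=
  exists theta, [/\ congruence theta, compatible theta F & theta a b].

Lemma congruence_join (A : algebra L) (theta1 theta2 : A -> A -> Prop) :
  congruence theta1 -> congruence theta2 ->
  congruence (clos_trans A (fun a b => theta1 a b \/ theta2 a b)).
Proof.
move=> [e1 c1] [e2 c2]; set J := clos_trans _ _.
have Jrefl a : J a a by apply: t_step; left; reflexivity.
split; first split=> //.
- move=> a b; elim=> {a b} [a b [ab|ab]|a b c _ ba _ cb].
  + by apply: t_step; left; symmetry.
  + by apply: t_step; right; symmetry.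
  + exact: t_trans cb ba.
- by move=> a b c; exact: t_trans.
move=> f xs ys xys.
pose mix k := [ffun i : 'I_(arity f) => if i < k then ys i else xs i].
have mixP k : k <= arity f -> J (oper A f xs) (oper A f (mix k)).
  elim: k => [_|k IH ltk].
    have -> : mix 0 = xs by apply/ffunP => i; rewrite ffunE ltn0.
    exact: Jrefl.
  apply: t_trans (IH (ltnW ltk)) _; pose k' := Ordinal ltk.
  pose put x := [ffun i : 'I_(arity f) => if i == k' then x else mix k i].
  have -> : mix k = put (xs k').
    by apply/ffunP => i; rewrite !ffunE; case: eqP => // ->; rewrite ltnn.
  have -> : mix k.+1 = put (ys k').
    apply/ffunP => i; rewrite !ffunE ltnS leq_eqVlt -(inj_eq val_inj) /=.
    by case: eqP => //= ik; congr (ys _); apply: val_inj.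
  elim: (xys k') => [a b [ab|ab]|a b c _ ab _ bc]; last exact: t_trans ab bc.
  - apply: t_step; left; apply: c1 => i; rewrite !ffunE.
    by case: eqP => // _; reflexivity.
  - apply: t_step; right; apply: c2 => i; rewrite !ffunE.
    by case: eqP => // _; reflexivity.
have -> : ys = mix (arity f) by apply/ffunP => i; rewrite ffunE ltn_ord.
exact: mixP.
Qed.

Lemma LeibnizP (A : algebra L) (F : set A) :
  [/\ congruence (Leibniz F), compatible (Leibniz F) F &
      forall theta, congruence theta -> compatible theta F ->
        forall a b, theta a b -> Leibniz F a b].
Proof.
have join a b c : Leibniz F a b -> forall theta, congruence theta ->
    compatible theta F -> theta b c -> exists theta', [/\ congruence theta',
    compatible theta' F, theta' a c & forall x y, theta x y -> theta' x y].
  move=> [t1 [c1 F1 ab]] t2 c2 F2 bc.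
  exists (clos_trans A (fun a b => t1 a b \/ t2 a b)); split.
  - exact: congruence_join.
  - move=> x y; elim=> {x y} [x y [/F1|/F2] //|x y z _ xy _ yz /xy]; exact: yz.
  - by apply: (t_trans _ _ _ b); apply: t_step; [left|right].
  - by move=> x y xy; apply: t_step; right.
have ceq : congruence (@eq A).
  split=> [|f xs ys xys]; first by split=> // x y z -> ->.
  by congr oper; apply/ffunP.
have Feq : compatible (@eq A) F by move=> a b ->.
have Lrefl a : Leibniz F a a by exists eq.
have Ltrans a b c : Leibniz F a b -> Leibniz F b c -> Leibniz F a c.
  move=> ab [t [ct Ft bc]]; have [t' [ct' Ft' ac _]] := join _ _ _ ab t ct Ft bc.
  by exists t'.
split; last by move=> t ct Ft a b ab; exists t.
- split; first split=> //.
  + by move=> a b [t [ct Ft ab]]; exists t; split=> //; case: (ct) => e _; symmetry.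
  move=> f xs ys xys.
  have [t [ct Ft ext]] : exists t, [/\ congruence t, compatible t F &
      forall i, i \in enum 'I_(arity f) -> t (xs i) (ys i)].
    elim: (enum _) => [|i s [t [ct Ft IH]]]; first by exists eq.
    have tii : t (ys i) (ys i) by case: (ct) => e _; reflexivity.
    have [t' [ct' Ft' ti sub]] := join _ _ _ (xys i) t ct Ft tii.
    exists t'; split=> // j; rewrite inE => /orP[/eqP -> //|/IH]; exact: sub.
  exists t; split=> //; apply: ct.2 => i; apply: ext; exact: mem_enum.
- by move=> a b [t [_ Ft ab]]; exact: Ft ab.
Qed.

Definition deductive_filter (l : logic L) (A : algebra L) (F : set A) : Prop :=
  forall (Gamma : set (formula L)) (phi : formula L), entails l Gamma phi ->
  forall h : Fm L -> A, is_hom h -> h @` Gamma `<=` F -> F (h phi).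

Definition Mod_star (l : logic L) (A : algebra L) (F : set A) : Prop :=
  deductive_filter l F /\ forall a b, Leibniz F a b <-> a = b.

End Matrices.

Section Hierarchy.
Variable L : language.
Implicit Type l : logic L.

(* Var 0 and Var 1 play the role of x and y, the other variables that of the
   parameters; the homomorphisms h with h x = a and h y = b correspond to the
   choices of values for the parameters. *)
Definition defines_Leibniz l (rho : set (formula L)) : Prop :=
  forall (A : algebra L) (F : set A), deductive_filter l F ->
  forall a b : A, Leibniz F a b <->
    (forall h : Fm L -> A, is_hom h -> h (Var 0) = a -> h (Var 1) = b ->
      h @` rho `<=` F).

Definition congruence_formulas l (rho : set (formula L)) : Prop :=
  (forall phi, rho phi -> variables_in [set 0; 1] phi) /\ defines_Leibniz l rho.

Definition protoalgebraic l : Prop := exists rho, defines_Leibniz l rho.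

Definition equivalential l : Prop := exists rho, congruence_formulas l rho.

Definition has_finite_congruence_formulas l : Prop :=
  exists rho, finite_set rho /\ congruence_formulas l rho.

Definition finitely_equivalential l : Prop :=
  equivalential l /\ has_finite_congruence_formulas l.

Definition truth_implicitly_definable l : Prop :=
  forall (A : algebra L) (F G : set A), Mod_star l F -> Mod_star l G -> F = G.

(* The equations are between formulas in the single variable Var 0. *)
Definition truth_equational l : Prop :=
  exists tau : set (formula L * formula L),
    (forall e, tau e ->
      variables_in [set 0] e.1 /\ variables_in [set 0] e.2) /\
    forall (A : algebra L) (F : set A), Mod_star l F ->
      F = [set a : A | forall h : Fm L -> A, is_hom h -> h (Var 0) = a ->
                       forall e, tau e -> h e.1 = h e.2].

(* A constant term of C is a formula, possibly with variables, whose value in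
   each member of C does not depend on the valuation. *)
Definition constant_term (C : algebra L -> Prop) (one : formula L) : Prop :=
  forall A : algebra L, C A ->
  forall h h' : Fm L -> A, is_hom h -> is_hom h' -> h one = h' one.

Definition assertional l : Prop :=
  exists (C : algebra L -> Prop) (one : formula L), constant_term C one /\
    forall (Gamma : set (formula L)) (phi : formula L),
      entails l Gamma phi <->
      (forall A : algebra L, C A -> forall h : Fm L -> A, is_hom h ->
        h @` Gamma `<=` [set h one] -> h phi = h one).

Definition weakly_algebraizable l := protoalgebraic l /\ truth_equational l.

Definition regularly_weakly_algebraizable l :=
  assertional l /\ weakly_algebraizable l.

Definition algebraizable l := equivalential l /\ truth_equational l.

Definition finitely_algebraizable l :=
  algebraizable l /\ has_finite_congruence_formulas l.

Definition regularly_algebraizable l := assertional l /\ algebraizable l.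

Definition finitely_regularly_algebraizable l :=
  regularly_algebraizable l /\ has_finite_congruence_formulas l.

End Hierarchy.

Inductive level :=
  | Protoalgebraic
  | Equivalential
  | FinitelyEquivalential
  | TruthImplicitlyDefinable
  | TruthEquational
  | Assertional
  | WeaklyAlgebraizable
  | RegularlyWeaklyAlgebraizable
  | Algebraizable
  | FinitelyAlgebraizable
  | RegularlyAlgebraizable
  | FinitelyRegularlyAlgebraizable.

Definition in_level (K : level) (L : language) : logic L -> Prop :=
  match K with
  | Protoalgebraic => @protoalgebraic L
  | Equivalential => @equivalential L
  | FinitelyEquivalential => @finitely_equivalential L
  | TruthImplicitlyDefinable => @truth_implicitly_definable L
  | TruthEquational => @truth_equational L
  | Assertional => @assertional L
  | WeaklyAlgebraizable => @weakly_algebraizable L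
  | RegularlyWeaklyAlgebraizable => @regularly_weakly_algebraizable L
  | Algebraizable => @algebraizable L
  | FinitelyAlgebraizable => @finitely_algebraizable L
  | RegularlyAlgebraizable => @regularly_algebraizable L
  | FinitelyRegularlyAlgebraizable => @finitely_regularly_algebraizable L
  end.

(* A finite language is presented by the list of the arities of its symbols. *)
Definition finite_language (ars : seq nat) : language :=
  @Language 'I_(size ars) (fun i => nth 0 ars i).

Record finite_calculus := FiniteCalculus {
  arities : seq nat;
  rules : seq (rule (finite_language arities)) }.

Definition calculus_logic (H : finite_calculus) :
    logic (finite_language (arities H)) :=
  hilbert_logic [set r | List.In r (rules H)].

(* CodeSeq.code is the bijection from seq nat to nat given by
   code [::] = 0 and code (n :: s) = 2 ^ n * (2 * code s + 1). *)
Fixpoint formula_code (ars : seq nat) (phi : formula (finite_language ars)) :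
    nat :=
  match phi with
  | Var n => CodeSeq.code [:: 0; n]
  | App f ts => CodeSeq.code
      [:: 1, nat_of_ord f & [seq formula_code (ts i) | i <- enum 'I_(arity f)]]
  end.

Definition rule_code (ars : seq nat) (r : rule (finite_language ars)) : nat :=
  CodeSeq.code
    (formula_code (conclusion r) :: [seq formula_code phi | phi <- premises r]).

Definition calculus_code (H : finite_calculus) : nat :=
  CodeSeq.code [:: CodeSeq.code (arities H);
                   CodeSeq.code [seq rule_code r | r <- rules H]].

Lemma formula_code_inj (ars : seq nat) : injective (@formula_code ars).
Proof.
have Cinj := can_inj CodeSeq.codeK.
elim/formula_nested_ind => [m|f ts IH] [n|g us] /Cinj //; first by case=> ->.
case=> /ord_inj efg; subst g => /eq_in_map ets; congr App; apply/ffunP => i.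
by apply: IH; apply: ets; exact: mem_enum.
Qed.

Lemma rule_code_inj (ars : seq nat) : injective (@rule_code ars).
Proof.
move=> [ps c] [qs d] /(can_inj CodeSeq.codeK) /= [/formula_code_inj -> eps].
by rewrite (inj_map (@formula_code_inj ars) eps).
Qed.

Lemma calculus_code_inj : injective calculus_code.
Proof.
move=> [ar rs] [ar' rs'] /(can_inj CodeSeq.codeK) /= [/(can_inj CodeSeq.codeK) e].
move: rs'; rewrite -{}e => rs' /(can_inj CodeSeq.codeK) ers.
by rewrite (inj_map (@rule_code_inj ar) ers).
Qed.

(* recf n codes the partial recursive functions of n arguments; in Rec, the
   first argument is the recursion variable, and in Mu the argument searched
   for comes first. *)
Inductive recf : nat -> Type :=
  | Zero : recf 0
  | Succ : recf 1
  | Proj n : 'I_n -> recf n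
  | Comp m n : recf m -> ('I_m -> recf n) -> recf n
  | Rec n : recf n -> recf n.+2 -> recf n.+1
  | Mu n : recf n.+1 -> recf n.

Fixpoint iterate_rel (base : nat -> Prop) (step : nat -> nat -> nat -> Prop)
    (k y : nat) : Prop :=
  match k with
  | 0 => base y
  | k'.+1 => exists r, iterate_rel base step k' r /\ step k' r y
  end.

(* returns p v y: the function coded by p is defined at v, with value y. *)
Fixpoint returns (n : nat) (p : recf n) : n.-tuple nat -> nat -> Prop :=
  match p with
  | Zero => fun _ y => y = 0
  | Succ => fun v y => y = (thead v).+1
  | Proj n i => fun v y => y = tnth v i
  | Comp m n f g => fun v y => exists w : m.-tuple nat,
      (forall i, returns (g i) v (tnth w i)) /\ returns f w y
  | Rec n f g => fun v y =>
      let v' := [tuple of behead v] in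
      iterate_rel (returns f v')
        (fun k r => returns g [tuple of k :: r :: v']) (thead v) y
  | Mu n f => fun v y => returns f [tuple of y :: v] 0 /\
      forall k, k < y -> exists r, returns f [tuple of k :: v] r.+1
  end.

(* p decides Q on the inputs satisfying the promise P; nothing is required,
   not even termination, on the other inputs. *)
Definition decides_on (I : Type) (code : I -> nat) (P Q : I -> Prop)
    (p : recf 1) : Prop :=
  forall x, P x ->
    (Q x -> returns p [tuple code x] 1) /\ (~ Q x -> returns p [tuple code x] 0).

Definition decidable_on (I : Type) (code : I -> nat) (P Q : I -> Prop) : Prop :=
  exists p : recf 1, decides_on code P Q p.

Lemma returns_fun (n : nat) (p : recf n) (v : n.-tuple nat) (y z : nat) :
  returns p v y -> returns p v z -> y = z.
Proof.
elim: p v y z => {n} [|||m n f IHf g IHg|n f IHf g IHg|n f IHf] /=.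
- by move=> v y z -> ->.
- by move=> v y z -> ->.
- by move=> n i v y z -> ->.
- move=> v y z [w [gw fy]] [w' [gw' fz]].
  have eww : w = w' by apply: eq_from_tnth => i; exact: IHg (gw i) (gw' i).
  by rewrite -eww in fz; exact: IHf fy fz.
- move=> v; elim: (thead v) => [|k IH] y z /=; first exact: IHf.
  by move=> [r [hr gy]] [r' [/(IH _ _ hr) <- gz]]; exact: IHg gy gz.
- move=> v y z [fy ly] [fz lz]; case: (ltngtP y z) => // [/lz|/ly] [r].
  + by move=> /(IHf _ _ _ fy).
  + by move=> /(IHf _ _ _ fz).
Qed.

(* Main.v *)
Require Import Defs.
From mathcomp Require Import all_boot.
From mathcomp Require Import boolp classical_sets cardinality.

Set Implicit Arguments.
Unset Strict Implicit.
Unset Printing Implicit Defensive.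

Local Open Scope classical_set_scope.

(* A Hilbert calculus is read as a logic program: a formula is an atom and a
   rule is a Horn clause.  A fixed calculus in five symbols contains an
   interpreter of the partial recursive functions, and rules that make [eqv] a
   finite regular equivalence but have the additional premise [halt].  One
   more rule derives [halt] when the program [q] returns 0 at the code of its
   own text.  If it does, [halt] is a theorem and the logic is finitely
   regularly algebraizable.  If it does not, the rules with premise [halt] are
   idle; then filters are unconstrained outside the evaluation formulas, which
   refutes protoalgebraicity, implicit definability of truth and assertionality.
   The code of the calculus is a recursive function of the code of the text of
   [q], so a decision procedure yields a [q] that first computes the code of
   its own calculus and then decides it, returning 0 exactly when it should
   have returned 1. *)

(** * Algebraic preliminaries *)

Section Interpretation.
Variable L : language.

Fixpoint interp (A : algebra L) (v : nat -> A) (phi : formula L) : A :=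
  match phi with
  | Var n => v n
  | App f ts => oper A f [ffun i => interp v (ts i)]
  end.

Lemma interp_hom (A : algebra L) (v : nat -> A) : @is_hom L (Fm L) A (interp v).
Proof. by []. Qed.

Lemma hom_interp (A : algebra L) (h : Fm L -> A) : is_hom h ->
  forall phi, h phi = interp (h \o Var) phi.
Proof.
move=> hh; elim/formula_nested_ind => // f ts IH /=.
by rewrite [LHS]hh; congr oper; apply/ffunP => i; rewrite !ffunE IH.
Qed.

(** [theta] need not be an equivalence: the lemma is also applied to [F (del_at a b)] before
    symmetry and transitivity are known. *)
Lemma interp_rel (A : algebra L) (theta : A -> A -> Prop) (V : set nat)
    (v w : nat -> A) :
  (forall f (xs ys : {ffun 'I_(arity f) -> A}),
    (forall i, theta (xs i) (ys i)) -> theta (oper A f xs) (oper A f ys)) ->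
  (forall n, V n -> theta (v n) (w n)) ->
  forall phi, variables_in V phi -> theta (interp v phi) (interp w phi).
Proof.
move=> ct vw; elim/formula_nested_ind => [n /vw //|f ts IH /= Vts].
by apply: ct => i; rewrite !ffunE; exact: IH.
Qed.

Lemma eq_interp (A : algebra L) (V : set nat) (v w : nat -> A) :
  (forall n, V n -> v n = w n) ->
  forall phi, variables_in V phi -> interp v phi = interp w phi.
Proof.
move=> vw phi; apply: (interp_rel (theta := eq)) => // f xs ys xys.
by congr oper; apply/ffunP.
Qed.

Lemma hom_comp (A B C : algebra L) (g : B -> C) (h : A -> B) :
  is_hom g -> is_hom h -> is_hom (g \o h).
Proof.
move=> hg hh f ts /=; rewrite hh hg; congr oper.
by apply/ffunP => i; rewrite !ffunE.
Qed.

Lemma interp_comp (A B : algebra L) (p : A -> B) (v : nat -> A) : is_hom p ->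
  forall phi, p (interp v phi) = interp (p \o v) phi.
Proof.
by move=> hp; exact: hom_interp (hom_comp hp (interp_hom v)).
Qed.

Lemma Cn_filter (l : logic L) (Gamma : set (formula L)) :
  @deductive_filter L l (Fm L) (Cn l Gamma).
Proof.
move=> Delta phi Dphi h hh sub.
apply: Cn_idempotent; apply: (Cn_monotone sub).
by apply: (Cn_structural hh); exists phi.
Qed.

(** The quotient by the Leibniz congruence. Its elements are the classes as sets, and its operations
    act through chosen representatives. *)
Lemma reduction (l : logic L) (A : algebra L) (F : set A) :
  deductive_filter l F ->
  exists (B : algebra L) (p : A -> B) (G : set B),
    [/\ is_hom p, deductive_filter l G, (forall a, G (p a) <-> F a),
        (forall a b, p a = p b <-> Leibniz F a b) & forall b, exists a, p a = b].
Proof.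
move=> dF; have [[[Lr Ls Lt] cong] comp _] := LeibnizP F.
pose cl a : set A := Leibniz F a.
have cle a b : Leibniz F a b -> cl a = cl b.
  move=> ab; apply/seteqP; split=> c; apply: Lt => //; exact: Ls.
pose T := {S : set A | exists a, S = cl a}.
pose p a : T := exist _ (cl a) (ex_intro _ a erefl).
pose s (S : T) : A := sval (cid (svalP S)).
have sP S : p (s S) = S.
  case: S => S ex; apply: eq_exist => /=; rewrite /s /=.
  by case: cid.
have pP a b : p a = p b <-> Leibniz F a b.
  split=> [/(congr1 sval) /= e|/cle e]; last exact: eq_exist.
  have : cl b b := Lr b; by rewrite -e.
have sp a : Leibniz F (s (p a)) a by apply/pP; rewrite sP.
case: (carrier_inhabited A) => a0.
pose B : algebra L := @Algebra L T (fun f ts => p (oper A f [ffun i => s (ts i)]))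
  (inhabits (p a0)).
pose G : set B := fun b => F (s b).
have hp : @is_hom L A B p.
  by move=> f ts; apply/pP; apply: cong => i; rewrite !ffunE; apply: Ls; exact: sp.
have GF a : G (p a) <-> F a.
  by split; apply: comp; [exact: sp|apply: Ls; exact: sp].
exists B, p, G; split=> //; last by move=> b; exists (s b).
move=> Gamma phi Gphi h hh sub.
(* Lifting the values of the variables through the section [s] gives a valuation in [A] that [p]
   maps back to [h]. *)
pose g := interp (s \o h \o Var).
have e psi : h psi = p (g psi).
  rewrite (hom_interp hh) /g (@interp_comp A B p) //.
  by apply: (@eq_interp _ setT) => [n _ /=|]; [rewrite sP|
     elim/formula_nested_ind: psi].
rewrite e; apply/GF; apply: (dF _ _ Gphi) => // _ [psi Gpsi <-].
by apply/GF; rewrite -e; apply: sub; exists psi.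
Qed.

End Interpretation.

(** * Logics with a regular equivalence formula *)

Section Equivalence.
Variables (L : language) (l : logic L) (del : formula L).
Hypothesis del_vars : variables_in [set 0; 1] del.

Definition del_at (A : algebra L) (a b : A) : A :=
  interp (fun n => if n == 0 then a else b) del.

Hypothesis del_refl : forall (A : algebra L) (F : set A),
  deductive_filter l F -> forall a, F (del_at a a).
Hypothesis del_mp : forall (A : algebra L) (F : set A),
  deductive_filter l F -> forall a b, F a -> F (del_at a b) -> F b.
Hypothesis del_cong : forall (A : algebra L) (F : set A),
  deductive_filter l F -> forall f (xs ys : {ffun 'I_(arity f) -> A}),
  (forall i, F (del_at (xs i) (ys i))) -> F (del_at (oper A f xs) (oper A f ys)).
Hypothesis del_regular : forall (A : algebra L) (F : set A),
  deductive_filter l F -> forall a b, F a -> F b -> F (del_at a b).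

(** If [a] and [b] are Leibniz related, so are [del a a], which lies in [F], and [del a b].
    Conversely, [F (del_at a b)] is a congruence compatible with [F]. *)
Lemma Leibniz_del (A : algebra L) (F : set A) : deductive_filter l F ->
  forall a b, Leibniz F a b <-> F (del_at a b).
Proof.
move=> dF a b; split.
  move=> [theta [[eqv ct] comp ab]]; apply: comp (del_refl dF a).
  apply: interp_rel ct _ _ del_vars => n _.
  by case: ifP => _ //; reflexivity.
pose theta a b := F (del_at a b).
(* Replacement inside [del] itself: with reflexivity and detachment it yields symmetry and
   transitivity. *)
have tc x y z w : theta x y -> theta z w -> theta (del_at x z) (del_at y w).
  move=> xy zw; apply: interp_rel (del_cong dF) _ _ del_vars => n _.
  by case: ifP.
have tr x : theta x x by exact: del_refl.
have ts x y : theta x y -> theta y x.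
  by move=> xy; apply: (del_mp dF (tr x)); exact: tc.
have tt x y z : theta x y -> theta y z -> theta x z.
  by move=> xy yz; apply: (del_mp dF xy); exact: tc.
move=> ab; exists theta; split=> //.
- by split=> [|f xs ys]; [split=> // x y z; exact: tt|exact: del_cong].
- by move=> x y xy Fx; exact: del_mp xy.
Qed.

Lemma del_congruence_formulas : congruence_formulas l [set del].
Proof.
split=> [_ -> //|A F dF a b].
have hd (h : Fm L -> A) : is_hom h -> h (Var 0) = a -> h (Var 1) = b ->
    h del = del_at a b.
  move=> hh ha hb; rewrite (hom_interp hh); apply: eq_interp del_vars => n.
  by move=> [->|->].
rewrite Leibniz_del //; split=> [Fab h hh ha hb _ [_ -> <-]|H].
  by rewrite hd.
pose h := interp (fun n => if n == 0 then a else b).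
by apply: (H h) => //; exists del.
Qed.

(** Stands in for the constant 1: in a reduced model the value of [del(x, x)] does not depend on
    [x]. *)
Definition del_unit : formula L := @del_at (Fm L) (Var 0) (Var 0).

Lemma hom_del_unit (A : algebra L) (h : Fm L -> A) : is_hom h ->
  h del_unit = del_at (h (Var 0)) (h (Var 0)).
Proof.
move=> hh; rewrite /del_unit /del_at interp_comp //.
by apply: eq_interp del_vars => n _ /=; case: ifP.
Qed.

Lemma Mod_star_eq (A : algebra L) (F : set A) : Mod_star l F ->
  forall a b, F a -> F b -> a = b.
Proof.
move=> [dF rF] a b Fa Fb; apply/rF/Leibniz_del => //.
exact: del_regular.
Qed.

(** By regularity a reduced filter has a single element, the value of [del(x, x)]. *)
Lemma del_truth_equational : truth_equational l.
Proof.
exists [set (Var 0, del_unit)]; split=> [_ -> /=|A F MF].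
  split=> //; rewrite /del_unit /del_at.
  move: del_vars; elim/formula_nested_ind: del => [n _ /=|f ts IH /= H i].
    by case: ifP.
  by rewrite ffunE; exact: IH.
have [dF rF] := MF; apply/seteqP; split=> a /=.
  move=> Fa h hh ha _ -> /=; rewrite hom_del_unit // ha.
  apply: (Mod_star_eq MF) => //; exact: del_refl.
move=> /(_ _ (interp_hom (fun=> a)) erefl _ erefl) /= ->.
rewrite hom_del_unit; [exact: del_refl|exact: interp_hom].
Qed.

(** The class consists of the algebras of reduced models. Completeness comes from reducing the
    theory of [Gamma] on the formula algebra. *)
Lemma del_assertional : assertional l.
Proof.
exists (fun A => exists F, @Mod_star L l A F), del_unit; split.
  move=> A [F MF] h h' hh hh'; apply: (Mod_star_eq MF);
    rewrite hom_del_unit //; apply: del_refl; exact: MF.1.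
move=> Gamma phi; split.
  move=> ent A [F MF] h hh sub; apply: (Mod_star_eq MF).
    apply: (MF.1 _ _ ent h hh) => x /sub ->.
    by rewrite hom_del_unit //; apply: del_refl; exact: MF.1.
  by rewrite hom_del_unit //; apply: del_refl; exact: MF.1.
move=> H; have dC := @Cn_filter L l Gamma.
have [B [p [G [hp dG GF pP surj]]]] := reduction dC.
(* The quotient is reduced because [p] commutes with [del], which expresses both Leibniz
   congruences. *)
have MG : Mod_star l G.
  split=> // x y; have [a <-] := surj x; have [b <-] := surj y.
  rewrite Leibniz_del // pP Leibniz_del // -GF.
  suff -> : p (del_at a b) = del_at (p a) (p b) by [].
  rewrite /del_at interp_comp //.
  by apply: eq_interp del_vars => n _ /=; case: ifP.
have Gunit : G (p del_unit) by rewrite hom_del_unit //; exact: del_refl.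
apply/GF; rewrite (H B _ p hp) //; first by exists G.
move=> _ [psi Gpsi <-]; apply: (Mod_star_eq MG) => //.
by apply/GF; exact: Cn_extensive.
Qed.

Lemma del_in_level (K : level) : in_level K l.
Proof.
have cf := del_congruence_formulas; have te := del_truth_equational.
have as_ := del_assertional.
have eqv : equivalential l by exists [set del].
have pro : protoalgebraic l by case: cf => _; exists [set del].
have fin : has_finite_congruence_formulas l.
  by exists [set del]; split=> //; exact: finite_set1.
case: K => //=; rewrite /finitely_equivalential /weakly_algebraizable
  /regularly_weakly_algebraizable /algebraizable /finitely_algebraizable
  /regularly_algebraizable /finitely_regularly_algebraizable;
  rewrite /regularly_algebraizable /algebraizable /weakly_algebraizable; do ?by [].
have [tau [_ tauP]] := te.
by move=> A F G /tauP -> /tauP ->.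
Qed.

End Equivalence.

(** * The calculus *)

Definition closed_under (L : language) (H : set (rule L)) (A : algebra L)
    (F : set A) : Prop :=
  forall r, H r -> forall h : Fm L -> A, is_hom h ->
    (forall gamma, List.In gamma (premises r) -> F (h gamma)) ->
    F (h (conclusion r)).

Lemma deductive_filterP (L : language) (H : set (rule L)) (A : algebra L)
    (F : set A) :
  deductive_filter (hilbert_logic H) F <-> closed_under H F.
Proof.
split=> [dF r Hr h hh prem|cF Gamma phi der h hh sub].
  apply: (dF (fun gamma => List.In gamma (premises r))) hh _ => [|_ [g /prem ? <-] //].
  apply: (derivable_rule (sigma := id)) => // [f ts|gamma].
    by congr App; apply/ffunP => i; rewrite ffunE.
  exact: derivable_hyp.
elim: der => {phi} [phi Gphi|r sigma Hr hs _ IH]; first by apply: sub; exists phi.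
by apply: (cF r Hr (h \o sigma)) => //; exact: hom_comp.
Qed.

Lemma codom_ffun_nth (T : Type) (k : nat) (x : T) (s : seq T) : size s = k ->
  codom [ffun i : 'I_k => nth x s i] = s.
Proof.
move=> <-; rewrite codomE.
under eq_map => i do rewrite ffunE.
by rewrite (map_comp (nth x s) val) val_enum_ord map_nth_iota0 ?take_size.
Qed.

Lemma nth_codom_ord (T : Type) (k : nat) (d : T) (g : 'I_k -> T) (i : 'I_k) :
  nth d (codom g) i = g i.
Proof. by rewrite codomE (nth_map i) ?size_enum_ord // nth_ord_enum. Qed.

Lemma In_cat (T : Type) (x : T) (s t : seq T) :
  List.In x (s ++ t) <-> List.In x s \/ List.In x t.
Proof. exact: List.in_app_iff. Qed.

Lemma In_map (T U : Type) (f : T -> U) (y : U) (s : seq T) :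
  List.In y (map f s) <-> exists x, f x = y /\ List.In x s.
Proof. exact: List.in_map_iff. Qed.

Lemma In_enum (T : finType) (x : T) : List.In x (enum T).
Proof.
have : x \in enum T by rewrite mem_enum.
by elim: (enum T) => //= y s IH; rewrite inE => /orP[/eqP ->|/IH]; [left|right].
Qed.

Section Node.
Variable ars : seq nat.
Local Notation L := (finite_language ars).

(** [Var 0] fills missing positions, so the formula is the intended one for lists of length
    [arity f]. *)
Definition node (f : symbol L) (s : seq (formula L)) : formula L :=
  App f [ffun i : 'I_(arity f) => nth (Var 0) s i].

Lemma hom_node (A : algebra L) (h : Fm L -> A) f s : is_hom h ->
  h (node f s) = oper A f [ffun i : 'I_(arity f) => nth (h (Var 0)) (map h s) i].
Proof.
move=> hh; rewrite [LHS]hh; congr oper; apply/ffunP => i; rewrite !ffunE.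
case: (ltnP i (size s)) => lt; first by rewrite (nth_map (Var 0)).
by rewrite !nth_default ?size_map.
Qed.

Lemma formula_code_node f s : size s = arity f ->
  formula_code (node f s) =
  CodeSeq.code [:: 1, nat_of_ord f & map (@formula_code ars) s].
Proof.
move=> sz; congr (CodeSeq.code [:: 1, _ & _]).
rewrite -[in RHS](codom_ffun_nth (Var 0) sz) codomE -map_comp.
by apply: eq_map => i.
Qed.

End Node.

Definition lang := finite_language [:: 0; 0; 2; 2; 3].

Definition leaf_symbol : symbol lang := @Ordinal 5 0 isT.
Definition halt_symbol : symbol lang := @Ordinal 5 1 isT.
Definition pair_symbol : symbol lang := @Ordinal 5 2 isT.
Definition eqv_symbol : symbol lang := @Ordinal 5 3 isT.
Definition eval_symbol : symbol lang := @Ordinal 5 4 isT.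

Definition leaf : formula lang := node leaf_symbol [::].
Definition halt : formula lang := node halt_symbol [::].
Definition pair_ a b : formula lang := node pair_symbol [:: a; b].
Definition eqv a b : formula lang := node eqv_symbol [:: a; b].
Definition eval a b c : formula lang := node eval_symbol [:: a; b; c].

(** Mirrors the formulas over [lang] without finite functions as arguments, which allows matching on
    nested shapes. *)
Inductive term :=
  | TVar of nat
  | TLeaf
  | THalt
  | TPair of term & term
  | TEqv of term & term
  | TEval of term & term & term.

Fixpoint formula_of (t : term) : formula lang :=
  match t with
  | TVar n => Var n
  | TLeaf => leaf
  | THalt => halt
  | TPair a b => pair_ (formula_of a) (formula_of b)
  | TEqv a b => eqv (formula_of a) (formula_of b)
  | TEval a b c => eval (formula_of a) (formula_of b) (formula_of c)
  end.

Fixpoint inst (v : nat -> term) (t : term) : term :=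
  match t with
  | TVar n => v n
  | TLeaf => TLeaf
  | THalt => THalt
  | TPair a b => TPair (inst v a) (inst v b)
  | TEqv a b => TEqv (inst v a) (inst v b)
  | TEval a b c => TEval (inst v a) (inst v b) (inst v c)
  end.

Definition succ := TPair TLeaf.

Definition numeral (n : nat) : term := iter n succ TLeaf.

Definition term_list (s : seq term) : term := foldr TPair TLeaf s.

Definition numerals (s : seq nat) : term := term_list (map numeral s).

Definition mark k (a : term) := TPair (numeral k) a.

Fixpoint quote (n : nat) (p : recf n) : term :=
  match p with
  | Zero => mark 0 TLeaf
  | Succ => mark 1 TLeaf
  | Proj n i => mark 2 (numeral i)
  | Comp m n f g =>
      mark 3 (TPair (quote f) (term_list [seq quote (g i) | i <- enum 'I_m]))
  | Rec n f g => mark 4 (TPair (quote f) (quote g))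
  | Mu n f => mark 5 (quote f)
  end.

(* [TEval (mark 6 gs) v w] evaluates the list of programs [gs] at [v], and
   [TEval (mark 7 f) (TPair y v) TLeaf] says that [f] is defined and positive
   at [k :: v] for all [k] below [y]. *)
Definition eval_clauses : seq (seq term * term) :=
  let x := TVar 0 in let y := TVar 1 in let z := TVar 2 in
  let v := TVar 3 in let f := TVar 4 in let g := TVar 5 in
  [:: ([::], TEval (mark 0 TLeaf) v TLeaf);
      ([::], TEval (mark 1 TLeaf) (TPair x v) (succ x));
      ([::], TEval (mark 2 TLeaf) (TPair x v) x);
      ([:: TEval (mark 2 z) v y], TEval (mark 2 (succ z)) (TPair x v) y);
      ([:: TEval (mark 6 g) v x; TEval f x y], TEval (mark 3 (TPair f g)) v y);
      ([::], TEval (mark 6 TLeaf) v TLeaf);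
      ([:: TEval f v x; TEval (mark 6 g) v y],
        TEval (mark 6 (TPair f g)) v (TPair x y));
      ([:: TEval f v y], TEval (mark 4 (TPair f g)) (TPair TLeaf v) y);
      ([:: TEval (mark 4 (TPair f g)) (TPair x v) y;
           TEval g (TPair x (TPair y v)) z],
        TEval (mark 4 (TPair f g)) (TPair (succ x) v) z);
      ([:: TEval (mark 7 f) (TPair x v) TLeaf; TEval f (TPair x v) TLeaf],
        TEval (mark 5 f) v x);
      ([::], TEval (mark 7 f) (TPair TLeaf v) TLeaf);
      ([:: TEval (mark 7 f) (TPair x v) TLeaf; TEval f (TPair x v) (succ y)],
        TEval (mark 7 f) (TPair (succ x) v) TLeaf)].

Definition eval_rules : seq (rule lang) :=
  [seq Rule (map formula_of c.1) (formula_of c.2) | c <- eval_clauses].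

Definition cong_rule (f : symbol lang) : rule lang :=
  Rule
    (halt :: [seq eqv (Var i) (Var (arity f + i))
               | i : 'I_(arity f) <- enum 'I_(arity f)])
    (eqv (App f [ffun i : 'I_(arity f) => Var i])
         (App f [ffun i : 'I_(arity f) => Var (arity f + i)])).

Definition halt_rules : seq (rule lang) :=
  let x := @Var lang 0 in let y := @Var lang 1 in
  [:: Rule [:: halt] (eqv x x);
      Rule [:: halt; x; eqv x y] y;
      Rule [:: halt; x; y] (eqv x y)] ++ map cong_rule (enum 'I_5).

(** The premise holds both the program and the numeral of its code: this is the self-application of
    the diagonal argument. *)
Definition start_rule (t : term) : rule lang :=
  Rule [:: formula_of
             (TEval t (numerals [:: formula_code (formula_of t)]) TLeaf)] halt.

Definition calculus t : finite_calculus :=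
  @FiniteCalculus [:: 0; 0; 2; 2; 3] (start_rule t :: eval_rules ++ halt_rules).

Section Hom.
Variables (A : algebra lang) (h : Fm lang -> A).
Hypothesis hh : is_hom h.

Lemma hom_eqv a b :
  h (eqv a b) = del_at (eqv (Var 0) (Var 1)) (h a) (h b).
Proof.
rewrite /del_at (hom_node _ _ hh) (hom_node _ _ (interp_hom _)).
by congr oper; apply/ffunP => -[[|[|i]] lti]; rewrite !ffunE.
Qed.

End Hom.

(** * The case where [halt] is a theorem *)

Section Halting.
Variable t : term.
Local Notation l := (calculus_logic (calculus t)).
Hypothesis l_halt : entails l set0 halt.

Lemma halt_in_filter (A : algebra lang) (F : set A) (h : Fm lang -> A) :
  deductive_filter l F -> is_hom h -> F (h halt).
Proof. by move=> dF hh; apply: (dF _ _ l_halt h hh) => _ [? []]. Qed.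

Lemma halting_filter (A : algebra lang) (F : set A) (r : rule lang)
    (h : Fm lang -> A) :
  deductive_filter l F -> List.In r halt_rules -> is_hom h ->
  (forall gamma, List.In gamma (behead (premises r)) -> F (h gamma)) ->
  F (h (conclusion r)).
Proof.
move=> dF Hr hh prem; have /deductive_filterP cF := dF.
apply: (cF r) => //; first by right; apply/In_cat; right.
have -> : premises r = halt :: behead (premises r).
  move: Hr; rewrite /halt_rules => /In_cat[/=[<-|[<-|[<-|]]]|] //.
  by move/In_map => [f [<-]].
by move=> gamma [<-|/prem //]; exact: (halt_in_filter dF hh).
Qed.

(** Each closure hypothesis of [del_in_level] is a rule of [halt_rules], freed of its premise
    [halt]. *)
Lemma halting_in_level (K : level) : in_level K l.
Proof.
pose val (A : algebra lang) (a b : A) := interp (fun n => if n == 0 then a else b).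
apply: (@del_in_level lang l (eqv (Var 0) (Var 1))) => [|A F dF a|A F dF a b Fa Fab
  |A F dF f xs ys Fxy|A F dF a b Fa Fb].
- by move=> -[[|[|i]] lti]; rewrite ffunE /=; [left|right|].
- have <- : val A a a (eqv (Var 0) (Var 0)) = del_at (eqv (Var 0) (Var 1)) a a.
    by rewrite hom_eqv.
  apply: (@halting_filter A F (Rule [:: halt] (eqv (Var 0) (Var 0)))
    (val A a a) dF) => //; first by left.
- apply: (@halting_filter A F (Rule [:: halt; Var 0; eqv (Var 0) (Var 1)] (Var 1))
    (val A a b) dF) => //; first by right; left.
  by move=> _ [<-|[<-|[]]] //=; rewrite hom_eqv.
- have [d] := carrier_inhabited A.
  (* The valuation reads [xs] and then [ys], as numbered in [cong_rule]; [d] only fills later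
     positions. *)
  pose v n := nth d (codom xs ++ codom ys) n.
  have vx (i : 'I_(arity f)) : v i = xs i.
    by rewrite /v nth_cat size_codom card_ord ltn_ord nth_codom_ord.
  have vy (i : 'I_(arity f)) : v (arity f + i) = ys i.
    by rewrite /v nth_cat size_codom card_ord ltnNge leq_addr addKn nth_codom_ord.
  have <- : interp v (App f [ffun i : 'I_(arity f) => Var i]) = oper A f xs.
    by congr oper; apply/ffunP => i; rewrite !ffunE /= vx.
  have <- : interp v (App f [ffun i : 'I_(arity f) => Var (arity f + i)]) =
      oper A f ys.
    by congr oper; apply/ffunP => i; rewrite !ffunE /= vy.
  rewrite -hom_eqv //.
  apply: (@halting_filter A F (cong_rule f) (interp v) dF) => //.
    apply/In_cat; right; apply/In_map.
    by exists f; split=> //; exact: In_enum.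
  move=> _ /In_map[i [<- _]].
  by rewrite hom_eqv //= vx vy.
- apply: (@halting_filter A F (Rule [:: halt; Var 0; Var 1] (eqv (Var 0) (Var 1)))
    (val A a b) dF) => //; first by right; right; left.
  by move=> _ [<-|[<-|[]]].
Qed.

End Halting.

(** * Completeness of the interpreter *)

Lemma In_nth (T : Type) (d : T) (s : seq T) k :
  k < size s -> List.In (nth d s k) s.
Proof. by elim: s k => [|x s IH] [|k] //=; [left|right; exact: IH]. Qed.

(** Curried, so that a clause applies as a function to proofs of its premises. *)
Definition horn (S : term -> Prop) (ps : seq term) (c : term) : Prop :=
  foldr (fun p Q => S p -> Q) (S c) ps.

Lemma hornP S ps c : horn S ps c <-> ((forall p, List.In p ps -> S p) -> S c).
Proof.
elim: ps => [|p ps [IH1 IH2]] /=; first by split=> [//|]; apply.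
split=> [Sp H|H Sp].
  by apply: IH1; [apply: Sp; apply: H; left|move=> q qs; apply: H; right].
by apply: IH2 => Sps; apply: H => q [<-|/Sps].
Qed.

(** Serves twice: the derivable terms form such a set, which gives completeness, and so do the
    [sound] terms. *)
Definition eval_closed (S : term -> Prop) : Prop :=
  forall c v, List.In c eval_clauses -> horn S (map (inst v) c.1) (inst v c.2).

Lemma returns_Rec n (f : recf n) (g : recf n.+2) k (v : n.-tuple nat) y :
  returns (Rec f g) [tuple of k :: v] y <->
  iterate_rel (returns f v) (fun i r => returns g [tuple of i :: r :: v]) k y.
Proof.
rewrite /= theadE.
have -> : returns f [tuple of behead [tuple of k :: v]] = returns f v.
  by congr (returns f); exact: val_inj.
have -> : (fun i r => returns g [tuple of i :: r :: behead [tuple of k :: v]]) =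
    (fun i r => returns g [tuple of i :: r :: v]) => //.
by apply/funext => i; apply/funext => r; congr (returns g); exact: val_inj.
Qed.

Section Completeness.
Variable S : term -> Prop.
Hypothesis S_closed : eval_closed S.

(** [s] lists the values of the variables of clause [k]; [TLeaf] fills the positions of absent
    ones. *)
Let clause k s : k < 12 ->
  let c := nth ([::], TLeaf) eval_clauses k in
  horn S (map (inst (nth TLeaf s)) c.1) (inst (nth TLeaf s) c.2).
Proof.
by move=> lt c; apply: S_closed; exact: In_nth.
Qed.

Lemma inst_numeral v n : inst v (numeral n) = numeral n.
Proof. by elim: n => //= n ->. Qed.

(** Induction on the program: each step of an evaluation is an application of one clause. *)
Lemma returns_complete n (p : recf n) (v : n.-tuple nat) y :
  returns p v y -> S (TEval (quote p) (numerals v) (numeral y)).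
Proof.
elim: p v y => {n} [|||m n f IHf g IHg|n f IHf g IHg|n f IHf] /=.
- move=> v _ ->; exact: (@clause 0 [:: TLeaf; TLeaf; TLeaf; numerals v]).
- case/tupleP=> x v _ -> /=; rewrite theadE.
  exact: (@clause 1 [:: numeral x; TLeaf; TLeaf; numerals v]).
- move=> n i v _ ->; rewrite (tnth_nth 0).
  case: i => i /=; rewrite -{1}(size_tuple v); case: v => /= v _.
  elim: v i => [|x v IH] [|i] // lt.
    exact: (@clause 2 [:: numeral x; TLeaf; TLeaf; numerals v]).
  by apply: (@clause 3 [:: numeral x; numeral (nth 0 v i); numeral i; numerals v]
    isT) (IH i lt).
- move=> v y [w [gw fy]].
  apply: (@clause 4 [:: numerals w; numeral y; TLeaf; numerals v; quote f; _]
    isT) (IHf _ _ fy).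
  (* Programs and values are now both indexed by [enum 'I_m], so one induction evaluates the list of
     programs. *)
  have -> : tval w = [seq tnth w i | i <- enum 'I_m].
    by rewrite -[LHS]map_tnth_enum.
  elim: (enum 'I_m) => [|i s IH].
    exact: (@clause 5 [:: TLeaf; TLeaf; TLeaf; numerals v]).
  exact: (@clause 6 [:: _; _; TLeaf; numerals v; _; _] isT) (IHg i _ _ (gw i)) IH.
- case/tupleP=> k v y; rewrite theadE.
  (* Abstract relations let the tuples in the definition of [returns], which equal [v] and
     [i :: r :: v] only as lists, be matched by conversion. *)
  have iter R1 R2 :
      (forall y, R1 y -> S (TEval (quote f) (numerals v) (numeral y))) ->
      (forall i r y, R2 i r y ->
        S (TEval (quote g) (numerals [:: i, r & v]) (numeral y))) ->
      iterate_rel R1 R2 k y -> S (TEval (mark 4 (TPair (quote f) (quote g)))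
        (numerals (k :: v)) (numeral y)).
    move=> H1 H2; elim: k y => [|k IH] y /=.
      move=> /H1; exact: (@clause 7 [:: TLeaf; numeral y; TLeaf; numerals v; _; _]).
    move=> [r [/IH kr /H2]].
    exact: (@clause 8 [:: numeral k; numeral r; numeral y; numerals v; _; _] isT) kr.
  by apply: iter => [z /IHf|i r z /IHg].
- move=> v y [/IHf fy pos].
  apply: (@clause 9 [:: numeral y; TLeaf; TLeaf; numerals v; quote f] isT) fy.
  (* Induction on the bound derives the premise with mark 7. *)
  elim: y pos => [|y IH] pos.
    exact: (@clause 10 [:: TLeaf; TLeaf; TLeaf; numerals v; quote f]).
  have [r /IHf fr] := pos y (ltnSn y).
  apply: (@clause 11 [:: numeral y; numeral r; TLeaf; numerals v; quote f] isT _ fr).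
  by apply: IH => k ltk; apply: pos; exact: leqW.
Qed.

End Completeness.

Lemma formula_of_inst v t :
  @interp lang (Fm lang) (formula_of \o v) (formula_of t) = formula_of (inst v t).
Proof.
have node_interp w f s : size s = arity f ->
    @interp lang (Fm lang) w (node f s) = node f (map (@interp lang (Fm lang) w) s).
  move=> sz; rewrite (hom_node _ _ (interp_hom _)); congr App.
  apply/ffunP => i; rewrite !ffunE.
  by apply: set_nth_default; rewrite size_map sz.
elim: t => [n|||a IHa b IHb|a IHa b IHb|a IHa b IHb c IHc] //.
- exact: (node_interp _ leaf_symbol [::]).
- exact: (node_interp _ halt_symbol [::]).
- rewrite [LHS](node_interp _ pair_symbol [:: _; _]) //=.
  by rewrite IHa IHb.
- rewrite [LHS](node_interp _ eqv_symbol [:: _; _]) //=.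
  by rewrite IHa IHb.
- rewrite [LHS](node_interp _ eval_symbol [:: _; _; _]) //=.
  by rewrite IHa IHb IHc.
Qed.

Lemma entails_eval_closed t :
  eval_closed (fun s => entails (calculus_logic (calculus t)) set0 (formula_of s)).
Proof.
move=> c v Hc; apply/hornP => prem; rewrite -formula_of_inst.
apply: (derivable_rule (r := Rule (map formula_of c.1) (formula_of c.2))).
- by right; apply/In_cat; left; apply/In_map; exists c.
- exact: interp_hom.
- move=> _ /In_map[p [<- Hp]]; rewrite formula_of_inst.
  by apply: prem; apply/In_map; exists p.
Qed.

(** * Soundness of the interpreter *)

(* Nothing is required of an ill-formed program or argument list. *)
Definition sound (t : term) : Prop :=
  if t is TEval P V Y then
    [/\ forall n (p : recf n) (v : n.-tuple nat),
          P = quote p -> V = numerals v -> exists2 y, Y = numeral y & returns p v y,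
        forall n (gs : seq (recf n)) (v : n.-tuple nat),
          P = mark 6 (term_list (map (@quote n) gs)) -> V = numerals v ->
          exists w : seq nat, [/\ Y = numerals w, size w = size gs
            & forall p i, i < size gs -> returns (nth p gs i) v (nth 0 w i)]
      & forall n (p : recf n.+1) K (v : n.-tuple nat),
          P = mark 7 (quote p) -> V = TPair K (numerals v) ->
          exists2 k, K = numeral k &
            forall j, j < k -> exists r, returns p [tuple of j :: v] r.+1]
  else False.

(** The twelve clauses in turn. A head tag below 6 forces the constructor of [p]; tags 6 and 7 leave
    only the second or third component to prove. *)
Lemma sound_closed : eval_closed sound.
Proof.
move=> c v; rewrite /eval_clauses.
do 12?[case=> [<-|]] => //=; move: (v 0) (v 1) (v 2) (v 3) (v 4) (v 5)
  => x y z {}v f g.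
- split=> // n p w; case: p w => // w _ _; by exists 0.
- split=> // n p w; case: p w => //; case/tupleP=> k w _ [-> _].
  by exists k.+1; rewrite //= theadE.
- split=> // n p w; case: p w => // {}n i; case: n i => [[]//|n] i.
  case/tupleP=> k w [ei] [-> _]; exists k => //=.
  by rewrite (tnth_nth 0); case: i ei => -[].
- case=> H _ _; split=> // n p w; case: p w => // {}n i; case: n i => [[]//|n] i.
  case/tupleP=> k w; case: i => -[//|i] lti [ei] [_ ev] /=.
  (* A projection with successor index is the preceding projection of the tail. *)
  have [y0 -> e] := H _ (Proj (Ordinal (lti : i < n))) w (congr1 _ ei) ev.
  by exists y0; rewrite // e !(tnth_nth 0).
- move=> [_ Hg _] [Hf _ _]; split=> // n p w; case: p w => // m {}n f' g' w.
  case=> ef; rewrite -[map _ _]/(map (@quote n \o g') _) map_comp => eg ev.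
  have [u [eu szu gu]] := Hg _ _ _ (congr1 (mark 6) eg) ev.
  rewrite size_map size_enum_ord in szu gu; have {}szu := introT eqP szu.
  have [r er fr] := Hf _ f' (Tuple szu) ef eu.
  exists r => //; exists (Tuple szu); split=> // i.
  have := gu (g' i) i (ltn_ord i).
  by rewrite (nth_map i) ?size_enum_ord // nth_ord_enum (tnth_nth 0).
- split=> [n p w|n gs w|//]; first by case: p w.
  by case: gs => // _ _; exists [::].
- move=> [Hf _ _] [_ Hg _]; split=> [n p w|n gs w|//]; first by case: p w.
  case: gs => // p gs [ef eg] ev.
  have [k -> pk] := Hf _ _ _ ef ev.
  have [u [-> szu gu]] := Hg _ gs _ (congr1 (mark 6) eg) ev.
  exists (k :: u); split=> [//||p' [|i] //]; first by rewrite /= szu.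
  exact: gu.
- move=> [Hf _ _]; split=> // n p w; case: p w => // {}n f' g'.
  case/tupleP=> k w [ef _] [ek ev]; have [r -> fr] := Hf _ _ w ef ev.
  by exists r => //; apply/(returns_Rec f' g' k w r); case: k ek.
- move=> [Hr _ _] [Hg _ _]; split=> // n p w; case: p w => // {}n f' g'.
  case/tupleP=> -[|k] w [ef eg] //= [ek ev].
  (* The premise concerns the same program at [k] and gives the iterate from which [g'] makes one
     more step. *)
  have [r er kr] := Hr _ (Rec f' g') [tuple of k :: w]
    (congr2 (fun a b => mark 4 (TPair a b)) ef eg) (congr2 TPair ek ev).
  have [s -> gs] := Hg _ g' [tuple of k :: r :: w] eg
    (congr2 TPair ek (congr2 TPair er ev)).
  by exists s => //; apply/(returns_Rec f' g' k.+1 w s); exists r; split=> //;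
    apply/(returns_Rec f' g' k w r).
- move=> [_ _ Hb] [Hf _ _]; split=> // n p w; case: p w => // {}n f' w [ef] ev.
  have [k ek pos] := Hb n f' x w (congr1 _ ef) (congr1 _ ev).
  (* [TLeaf] is the numeral of 0 only, so [f'] returns 0 at [k]. *)
  have [[|//] _ fk] := Hf _ f' [tuple of k :: w] ef (congr2 TPair ek ev).
  by exists k.
- split=> [n p w|//|n p K w _ [<- _]]; [by case: p w|by exists 0].
- move=> [_ _ Hb] [Hf _ _]; split=> [n p w|//|n p K w [ef] [<- ev]].
    by case: p w.
  have [k ek pos] := Hb n p x w (congr1 _ ef) (congr1 _ ev).
  have [[|r] // _ fr] := Hf _ p [tuple of k :: w] ef (congr2 TPair ek ev).
  exists k.+1; first by rewrite ek.
  move=> j; rewrite ltnS leq_eqVlt => /orP[/eqP ->|/pos //]; by exists r.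
Qed.

(** * Consistency and the non-halting case *)

Lemma In_rules t r : List.In r (rules (calculus t)) ->
  [\/ r = start_rule t,
      exists2 c, List.In c eval_clauses &
        r = Rule (map formula_of c.1) (formula_of c.2),
      r = Rule [:: halt] (eqv (Var 0) (Var 0)) \/
      r = Rule [:: halt; Var 0; eqv (Var 0) (Var 1)] (Var 1) \/
      r = Rule [:: halt; Var 0; Var 1] (eqv (Var 0) (Var 1))
    | exists f, r = cong_rule f].
Proof.
case=> [<-|]; first exact: Or41.
move=> /(@In_cat (rule lang) r eval_rules halt_rules)[].
  rewrite /eval_rules => /In_map[c [<- Hc]]; by apply: Or42; exists c.
rewrite /halt_rules => /In_cat[|/In_map[f [<- _]]]; last by apply: Or44; exists f.
by move=> /= H; apply: Or43; case: H => [<-|[<-|[<-|[]]]]; tauto.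
Qed.

Definition bool_algebra : algebra lang :=
  @Algebra lang bool (fun f ts =>
    if f == eqv_symbol then
      if codom ts is [:: a; b] then a == b else true
    else true) (inhabits true).

(** The filter of [true] satisfies every rule, whether or not [halt] is derivable, since [eqv] is
    equality there and evaluations are true. A variable may take the value [false]. *)
Lemma calculus_consistent t : consistent (calculus_logic (calculus t)).
Proof.
exists (Var 0) => H.
suff dF : @deductive_filter _ (calculus_logic (calculus t)) bool_algebra [set true].
  by have := dF _ _ H (@interp lang bool_algebra (fun=> false)) (interp_hom _);
    rewrite image_set0 => /(_ (sub0set _)).
apply/deductive_filterP => r Hr h hh.
have h_eqv a b : h (eqv a b) = (h a == h b).
  by rewrite /eqv hom_node //= codom_ffun_nth.
have h_true f s : f != eqv_symbol -> h (node f s) = true.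
  by rewrite hom_node //= => /negbTE ->.
case: (In_rules Hr) => [->|[c Hc ->]|[|[]] ->|[f ->]].
- by move=> _; rewrite /= /halt h_true.
- move=> _ /=; move: c Hc; rewrite /eval_clauses.
  by move=> c; do 12?[case=> [<-|]] => //= ; rewrite /eval h_true.
- by move=> _; rewrite /= h_eqv eqxx.
- move=> /= prem; have := prem _ (or_intror (or_intror (or_introl erefl))).
  by rewrite h_eqv => /eqP <-; exact: prem (or_intror (or_introl erefl)).
- move=> /= prem; rewrite h_eqv (prem _ (or_intror (or_introl erefl))).
  by rewrite (prem _ (or_intror (or_intror (or_introl erefl)))).
- move=> /= prem; rewrite h_eqv; apply/eqP; rewrite [LHS]hh [RHS]hh.
  congr (oper bool_algebra f _); apply/ffunP => i; rewrite !ffunE.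
  have := prem (eqv (Var i) (Var (arity f + i))); rewrite h_eqv => e.
  apply/eqP; apply: e; right; apply/In_map; exists i; split=> //.
  exact: In_enum.
Qed.

Lemma inst_list v s : inst v (term_list s) = term_list (map (inst v) s).
Proof. by elim: s => //= a s ->. Qed.

Lemma inst_numerals v s : inst v (numerals s) = numerals s.
Proof.
rewrite /numerals inst_list -map_comp; congr term_list.
by apply: eq_map => n; exact: inst_numeral.
Qed.

(** Quoted programs are closed, so all instances of the start rule speak of the same program. *)
Lemma inst_quote v n (p : recf n) : inst v (quote p) = quote p.
Proof.
elim: p => {n} [||n i|m n f IHf g IHg|n f IHf g IHg|n f IHf] //=.
- by rewrite inst_numeral.
- rewrite IHf inst_list -map_comp; congr (TPair _ (TPair _ (term_list _))).
  by apply: eq_map => i; exact: IHg.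
- by rewrite IHf IHg.
- by rewrite IHf.
Qed.

(** This keeps junk from matching a premise of an evaluation clause. *)
Lemma eval_premise c p : List.In c eval_clauses -> List.In p c.1 ->
  exists a b d, p = TEval a b d.
Proof.
by do 12?[case=> [<-|]] => //=; do 3?[case=> [<-|]] => //; do 3 eexists.
Qed.

(** * Filters on a labelled term algebra *)

Section TermAlgebra.
Variables (D : Type) (d0 : D).

(** [k] is the number of the symbol; the last case covers the leaf, number 0, and malformed
    lists. *)
Definition term_oper (k : nat) (s : seq term) : term :=
  match k, s with
  | 1, _ => THalt
  | 2, [:: a; b] => TPair a b
  | 3, [:: a; b] => TEqv a b
  | 4, [:: a; b; c] => TEval a b c
  | _, _ => TLeaf
  end.

(* The values of the operations do not depend on the labels in [D], so elements
   that differ in the label only are identified by the Leibniz congruence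
   unless the filter depends on the label. *)
Definition labelled_terms : algebra lang :=
  @Algebra lang (D * term) (fun f ts => (d0, term_oper f (map snd (codom ts))))
    (inhabits (d0, TLeaf)).

Section Hom.
Variable h : Fm lang -> labelled_terms.
Hypothesis hh : is_hom h.

Lemma labelled_node f s : size s = arity f ->
  h (node f s) = (d0, term_oper f [seq (h a).2 | a <- s]).
Proof.
move=> sz; rewrite hom_node //=; congr (_, term_oper _ _).
by rewrite codom_ffun_nth ?size_map // -map_comp.
Qed.

Lemma labelled_eqv a b : h (eqv a b) = (d0, TEqv (h a).2 (h b).2).
Proof. exact: labelled_node. Qed.

Lemma labelled_halt : h halt = (d0, THalt).
Proof. exact: labelled_node. Qed.

Lemma labelled_formula t : (h (formula_of t)).2 = inst (fun n => (h (Var n)).2) t.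
Proof.
elim: t => [n|||a IHa b IHb|a IHa b IHb|a IHa b IHb c IHc] //=.
- by rewrite /leaf labelled_node.
- by rewrite labelled_halt.
- by rewrite /pair_ labelled_node //= IHa IHb.
- by rewrite labelled_eqv IHa IHb.
- by rewrite /eval labelled_node //= IHa IHb IHc.
Qed.

End Hom.

Definition junk (x : labelled_terms) : Prop :=
  match x.2 with THalt | TEval _ _ _ => False | _ => True end.

Definition sound_or (S : set labelled_terms) : set labelled_terms :=
  fun x => sound x.2 \/ S x.

Variable q : recf 1.
Hypothesis q_nonzero :
  ~ returns q [tuple formula_code (formula_of (quote q))] 0.

(* As [halt] fails, the remaining rules only concern values of [eval], so that
   junk may be added freely. *)
Lemma sound_or_filter (S : set labelled_terms) : (forall x, S x -> junk x) ->
  deductive_filter (calculus_logic (calculus (quote q))) (sound_or S).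
Proof.
move=> S_junk; apply/deductive_filterP => r Hr h hh prem.
have halt_out : ~ sound_or S (h halt).
  by rewrite labelled_halt // => -[|/S_junk].
have eval_in a b c : sound_or S (h (formula_of (TEval a b c))) ->
    sound (h (formula_of (TEval a b c))).2.
  by case=> // /S_junk; rewrite /junk labelled_formula.
have nhalt : List.In halt (premises r) -> sound_or S (h (conclusion r)).
  by move/prem/halt_out.
case: (In_rules Hr) prem nhalt => [->|[c Hc ->]|[|[]] ->|[f ->]] /= prem nhalt;
  try by apply: nhalt; left.
(* A start rule with its premise in the filter would mean that [q] returns 0 at its own code. *)
- have := eval_in (quote q) (numerals [:: formula_code (formula_of (quote q))])
    TLeaf (prem _ (or_introl erefl)).
  rewrite labelled_formula // => -[Hq _ _].
  have [] := Hq _ q [tuple formula_code (formula_of (quote q))].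
  + exact: inst_quote.
  + exact: (inst_numerals _ [:: formula_code (formula_of (quote q))]).
  + by case=> // _ /q_nonzero.
- left; rewrite labelled_formula //.
  have /hornP := sound_closed (fun n => (h (Var n)).2) Hc; apply.
  move=> _ /In_map[p [<- Hp]]; rewrite -labelled_formula //.
  have Fp : sound_or S (h (formula_of p)).
    by apply: prem; apply/In_map; exists p.
  have [a [b [d ep]]] := eval_premise Hc Hp.
  by rewrite ep in Fp *; exact: eval_in.
Qed.

End TermAlgebra.

(** * Refutation of every level *)

Section Nonhalting.
Variable q : recf 1.
Hypothesis q_nonzero :
  ~ returns q [tuple formula_code (formula_of (quote q))] 0.
Local Notation l := (calculus_logic (calculus (quote q))).

(** A defining set would make the Leibniz congruence monotone in the filter. But two copies of
    [TLeaf] with different labels are related for [F] and separated by the larger filter [G]. *)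
Lemma not_protoalgebraic : ~ protoalgebraic l.
Proof.
case=> rho rhoP.
pose A := labelled_terms false; pose F : set A := sound_or (fun=> False).
pose G : set A := sound_or (eq (true, TLeaf)).
have dF : deductive_filter l F by apply: sound_or_filter.
have dG : deductive_filter l G.
  by apply: sound_or_filter => // _ <-.
have FG : F `<=` G by move=> x [|//]; left.
have LF : @Leibniz _ A F (true, TLeaf) (false, TLeaf).
  exists (fun x y => x.2 = y.2); split=> //.
    split; first by split=> // x y z -> ->.
    move=> f xs ys e /=; congr (term_oper _ _).
    by rewrite !codomE -!map_comp; apply: eq_map => i /=; exact: e.
  by move=> x y e [|//]; rewrite e; left.
have : @Leibniz _ A G (true, TLeaf) (false, TLeaf).
  apply/(rhoP A G dG) => h hh h0 h1 x hx; apply: FG.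
  by move/(rhoP A F dF): LF; apply; [exact: hh|..].
case=> theta [_ comp /comp]; case; [by right|by []|by []].
Qed.

Definition diagonal (x : labelled_terms tt) : Prop :=
  exists a, x.2 = TEqv a a.

(** A filter whose members of the form [TEqv a b] are those with [a = b] is reduced. Two such
    filters differ at [TVar 0]. *)
Lemma not_truth_implicitly_definable : ~ truth_implicitly_definable l.
Proof.
have Mod (S : set (labelled_terms tt)) : (forall x, S x -> junk x) ->
    (forall a b, S (tt, TEqv a b) <-> a = b) -> Mod_star l (sound_or S).
  move=> S_junk S_eqv; split; first exact: sound_or_filter.
  move=> [[] a] [[] b]; split=> [|->]; last by have [[[]]] := LeibnizP (sound_or S).
  case=> theta [[[r _ _] ct] comp ab].
  suff : sound_or S (tt, TEqv a b) by case=> // /S_eqv ->.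
  pose v x y n : labelled_terms tt := (tt, if n == 0 then x else y).
  have vE x y : interp (v x y) (eqv (Var 0) (Var 1)) = (tt, TEqv x y).
    by rewrite labelled_eqv.
  have -> : (tt, TEqv a b) = interp (v a b) (eqv (Var 0) (Var 1)) by rewrite vE.
  (* Replacing the second [a] by [b] moves [TEqv a a], which is in the filter, to [TEqv a b]. *)
  apply: (comp (interp (v a a) (eqv (Var 0) (Var 1)))).
    apply: (interp_rel (V := setT) ct) => [n _|[[|[|i]] lti]].
    + by rewrite /v; case: ifP.
    + by rewrite ffunE.
    + by rewrite ffunE.
    + by [].
  by rewrite vE; right; apply/S_eqv.
pose S1 : set (labelled_terms tt) := diagonal.
pose S2 : set (labelled_terms tt) := fun x => diagonal x \/ x.2 = TVar 0.
move=> /(_ _ (sound_or S1) (sound_or S2)) H.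
have /(congr1 (fun F => F (tt, TVar 0))) : sound_or S1 = sound_or S2.
  apply: H; apply: Mod.
  - by move=> x [a]; rewrite /junk => ->.
  - by move=> a b; split=> [[c [-> ->]]|->] //; exists b.
  - by move=> x [[a]|]; rewrite /junk => ->.
  - by move=> a b; split=> [[[c [-> ->]]|]|->] //; left; exists b.
by rewrite /sound_or /= => e; have [//|[]//] : sound (TVar 0) \/ S1 (tt, TVar 0)
  by rewrite e; right; right.
Qed.

(** In an assertional logic [x], [y] and [eqv x x] entail [eqv x y]: the premises give [x] and [y]
    the value 1 and say that [eqv] maps 1, 1 to 1. *)
Lemma not_assertional : ~ assertional l.
Proof.
case=> C [one [_ CP]].
pose Gamma : set (formula lang) := [set Var 0; Var 1; eqv (Var 0) (Var 0)].
have : entails l Gamma (eqv (Var 0) (Var 1)).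
  apply/CP => A CA h hh sub.
  have h0 : h (Var 0) = h one by apply: sub; exists (Var 0) => //; left; left.
  have h1 : h (Var 1) = h one by apply: sub; exists (Var 1) => //; left; right.
  have e : h (eqv (Var 0) (Var 0)) = h one.
    by apply: sub; exists (eqv (Var 0) (Var 0)) => //; right.
  by rewrite -e !hom_eqv // h0 h1.
(* The junk consists of the values of the three premises; the value of the conclusion stays
   outside. *)
pose S (x : labelled_terms tt) : Prop :=
  [\/ x.2 = TVar 0, x.2 = TVar 1 | x.2 = TEqv (TVar 0) (TVar 0)].
have dS : deductive_filter l (sound_or S).
  by apply: sound_or_filter => // x []; rewrite /junk => ->.
pose h := @interp lang (labelled_terms tt) (fun n => (tt, TVar n)).
move=> /dS /(_ h (interp_hom _)); rewrite labelled_eqv //; case=> [_ [g Gg <-]|//|[]//].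
case: Gg => [[->|->]|->].
- by right; constructor 1.
- by right; constructor 2.
- by rewrite labelled_eqv //; right; constructor 3.
Qed.

(** Each level implies one of the three refuted properties. *)
Lemma nonhalting_not_in_level (K : level) : ~ in_level K l.
Proof.
have np := not_protoalgebraic; have nt := not_truth_implicitly_definable.
have na := not_assertional.
have ne : ~ equivalential l by case=> rho [_ H]; apply: np; exists rho.
have nte : ~ truth_equational l.
  by case=> tau [_ tauP]; apply: nt => A F G /tauP -> /tauP ->.
case: K => //= [[/ne]|[/np]|[/na]|[/ne]|[[/ne]]|[/na]|[[/na]]] //.
Qed.

End Nonhalting.

(** * Recursiveness of the code of the calculus *)

Definition computable (n : nat) (F : n.-tuple nat -> nat) : Prop :=
  exists p : recf n, forall v, returns p v (F v).

Lemma computable_comp m n (G : m.-tuple nat -> nat)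
    (H : 'I_m -> n.-tuple nat -> nat) :
  computable G -> (forall i, computable (H i)) ->
  computable (fun v => G [tuple H i v | i < m]).
Proof.
move=> [p pG] /choice[qs qH]; exists (Comp p qs) => v /=.
exists [tuple H i v | i < m]; split; last exact: pG.
by move=> i; rewrite tnth_mktuple; exact: qH.
Qed.

Lemma computable_comp1 n (g : nat -> nat) (F : n.-tuple nat -> nat) :
  computable (fun v : 1.-tuple nat => g (thead v)) -> computable F ->
  computable (fun v => g (F v)).
Proof.
move=> cg cF; have [p pP] := computable_comp cg (fun _ : 'I_1 => cF).
by exists p => v; have := pP v; rewrite /thead tnth_mktuple.
Qed.

Lemma computable_succ n (F : n.-tuple nat -> nat) :
  computable F -> computable (fun v => (F v).+1).
Proof. by apply: computable_comp1; exists Succ. Qed.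

Lemma computable_const n k : computable (fun _ : n.-tuple nat => k).
Proof.
elim: k => [|k IH]; last exact: computable_succ.
exists (Comp Zero (fun i : 'I_0 => Proj (widen_ord (leq0n n) i))) => v /=.
by exists [tuple]; split=> // -[].
Qed.

Lemma computable_proj n (i : 'I_n) : computable (fun v => tnth v i).
Proof. by exists (Proj i). Qed.

Lemma computable_iter n (g : nat -> nat) (N F : n.-tuple nat -> nat) :
  computable (fun v : 1.-tuple nat => g (thead v)) ->
  computable N -> computable F -> computable (fun v => iter (N v) g (F v)).
Proof.
move=> cg [pN hN] [pF hF].
have [pg hg] : computable (fun v : n.+2.-tuple nat => g (tnth v (inord 1))).
  by apply: computable_comp1 => //; exact: computable_proj.
(* The counter [N v] is put before [v], since [Rec] recurs on its first argument. *)
exists (Comp (Rec pF pg) (fun i => if unlift ord0 i is Some j then Proj j else pN)).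
move=> v /=; exists [tuple of N v :: v]; split.
  move=> i; case: unliftP => [j ->|->]; first by rewrite tnthS.
  by rewrite tnth0.
apply/(returns_Rec pF pg (N v) v).
elim: (N v) => [|k IH] /=; first exact: hF.
exists (iter k g (F v)); split=> //.
have := hg [tuple of k :: iter k g (F v) :: v].
by rewrite (tnth_nth 0) inordK.
Qed.

(** The code of [n :: s] arises by [n] doublings of [2 * code s + 1], and doubling is itself an
    iteration. *)
Lemma computable_code_cons n (F : n.-tuple nat -> nat)
    (s : n.-tuple nat -> seq nat) :
  computable F -> computable (fun v => CodeSeq.code (s v)) ->
  computable (fun v => CodeSeq.code (F v :: s v)).
Proof.
move=> cF cs.
have double_iter k : k.*2 = iter k (fun x => x.+2) 0.
  by elim: k => //= k <-.
have cd m (H : m.-tuple nat -> nat) : computable H -> computable (fun v => (H v).*2).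
  move=> cH; under [X in computable X]funext => v do rewrite double_iter.
  apply: computable_iter => //; last exact: computable_const.
  by do 2 apply: computable_succ; exact: (computable_proj ord0).
have exp_iter k x : 2 ^ k * x = iter k double x.
  by elim: k => [|k IH]; rewrite ?mul1n // expnS -mulnA mul2n IH.
under [X in computable X]funext => v do rewrite /= exp_iter.
apply: computable_iter => //; last by apply: computable_succ; exact: cd.
by apply: cd; exact: (computable_proj ord0).
Qed.

(** Only the start rule varies with [t], and its code depends only on that of [t]: the code of the
    numeral is an iterate of the code of [succ]. *)
Lemma computable_calculus_code : exists2 F : nat -> nat,
  computable (fun v : 1.-tuple nat => F (thead v)) &
  forall t, F (formula_code (formula_of t)) = calculus_code (calculus t).
Proof.
pose lc := formula_code leaf.
(* Tag 1 marks an application; 2 and, below, 4 are the numbers of the symbols for pairs and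
   evaluation. *)
pose pc (a b : nat) := CodeSeq.code [:: 1; 2; a; b].
pose ec m := CodeSeq.code [:: 1; 4; m; pc (iter m (pc lc) lc) lc; lc].
pose R := map (@rule_code _) (eval_rules ++ halt_rules).
exists (fun m => CodeSeq.code [:: CodeSeq.code [:: 0; 0; 2; 2; 3];
  CodeSeq.code (CodeSeq.code [:: formula_code halt; ec m] :: R)]).
  have cc k : computable (fun _ : 1.-tuple nat => k) := computable_const 1 k.
  have cp a b : computable a -> computable b ->
      computable (fun v : 1.-tuple nat => pc (a v) (b v)).
    by move=> ca cb; do ?apply: computable_code_cons.
  have cm : computable (@thead 0 nat) := computable_proj ord0.
  have cn : computable (fun v : 1.-tuple nat => pc (iter (thead v) (pc lc) lc) lc).
    by apply: (cp _ _ _ (cc lc)); apply: computable_iter => //; exact: (cp (fun=> lc)).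
  have cons n F s := @computable_code_cons n F s.
  apply: (cons _ _ _ (cc _)); apply: (cons _ _ (fun=> [::]) _ (cc 0)).
  apply: (cons _ _ (fun=> R) _ (cc _)).
  apply: (cons _ _ _ (cc _)); apply: (cons _ _ (fun=> [::]) _ (cc 0)).
  apply: (cons _ _ _ (cc _)); apply: (cons _ _ _ (cc _)).
  apply: (cons _ _ _ cm); apply: (cons _ _ _ cn).
  exact: (cons _ _ (fun=> [::]) (cc _) (cc 0)).
move=> t.
have pcE a b : formula_code (pair_ a b) = pc (formula_code a) (formula_code b).
  exact: formula_code_node.
have numE n : formula_code (formula_of (numeral n)) = iter n (pc lc) lc.
  by elim: n => //= n <-; exact: pcE.
have startE : rule_code (start_rule t) =
    CodeSeq.code [:: formula_code halt; ec (formula_code (formula_of t))].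
  transitivity (CodeSeq.code [:: formula_code halt; formula_code (formula_of
    (TEval t (numerals [:: formula_code (formula_of t)]) TLeaf))]).
    reflexivity.
  congr (CodeSeq.code [:: _; _]).
  transitivity (CodeSeq.code [:: 1; 4; formula_code (formula_of t);
    formula_code (pair_ (formula_of (numeral (formula_code (formula_of t)))) leaf);
    lc]).
    exact: formula_code_node.
  by rewrite pcE numE.
rewrite -startE /calculus_code.
congr (CodeSeq.code [:: _; CodeSeq.code _]).
Qed.

(** * The diagonal argument *)

Theorem theorem4p10 (K : level) :
  ~ decidable_on calculus_code
      (fun H : finite_calculus => consistent (calculus_logic H))
      (fun H : finite_calculus => in_level K (calculus_logic H)).
Proof.
case=> p pP; have [F [c cP] FE] := computable_calculus_code.
pose q : recf 1 := Comp p (fun _ : 'I_1 => c).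
pose x := [tuple formula_code (formula_of (quote q))].
pose H := calculus (quote q).
have q_code y : returns p [tuple calculus_code H] y -> returns q x y.
  move=> py; exists [tuple calculus_code H]; split=> // i.
  by rewrite (ord1 i) -FE; exact: cP.
have [yes no] := pP H (calculus_consistent _).
(* If [q] returns 0, then [halt] is derivable and [p], hence [q], also returns 1. *)
have [q0|q0] := pselect (returns q x 0).
  suff /yes/q_code/(returns_fun q0) : in_level K (calculus_logic H) by [].
  apply: halting_in_level.
  have closed := entails_eval_closed (quote q).
  apply: (derivable_rule (r := start_rule (quote q)) (sigma := id)) => //.
  + by left.
  + by move=> f ts; congr App; apply/ffunP => i; rewrite ffunE.
  + by move=> _ [<-|//]; exact: (returns_complete closed q0).
(* Otherwise, divergence of [q] included, the logic is outside the level, so [p] and hence [q]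
   return 0. *)
by apply: (q0); apply/q_code/no; exact: nonhalting_not_in_level.
Qed.
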